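(* Let $G$ be a finite simple graph that is $\{\text{co-claw}, \text{co-gem}\}$-free. Then $\mathrm{had}_2(G) \geq \chi(G)$.
   Context: Graphs are finite, loopless and without parallel edges. $\chi(G)$ denotes the chromatic number of $G$, and $A\sqcup B$ denotes the disjoint union of graphs $A$ and $B$. For a set $S$ of graphs, $G$ is $S$-free if no induced subgraph of $G$ is isomorphic to a member of $S$. The co-claw is $K_3\sqcup K_1$ (the complement of the claw $K_{1,3}$). The co-gem is $P_4\sqcup K_1$, where $P_4$ is the path on 4 vertices. An $H$-model in a graph $G$ is a collection $\{S_x : x\in V(H)\}$ of pairwise disjoint non-empty connected subsets of $V(G)$ (each $S_x$ induces a connected subgraph of $G$) such that there is an edge of $G$ between a vertex of $S_x$ and a vertex of $S_y$ whenever $xy\in E(H)$; the sets $S_x$ are called branch sets. An $H$-model is small if every branch set has size $1$ or $2$. $\mathrm{had}_2(G)$ is the maximum integer $t$ such that $G$ has a small $K_t$-model. *)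

(* Defs.v *)
From mathcomp Require Import all_boot.

Set Implicit Arguments.
Unset Strict Implicit.
Unset Printing Implicit Defensive.

Record sgraph := SGraph {
  vertex :> finType;
  adj : rel vertex;
  adj_sym : symmetric adj;
  adj_irr : irreflexive adj }.

Definition iso (G H : sgraph) : Prop :=
  exists2 f : G -> H, bijective f & forall x y, adj (f x) (f y) = adj x y.

Section Constructions.

Definition complete_rel n : rel 'I_n := fun i j => i != j.

Fact complete_sym n : symmetric (@complete_rel n).
Proof. by move=> i j; rewrite /complete_rel eq_sym. Qed.

Fact complete_irr n : irreflexive (@complete_rel n).
Proof. by move=> i; rewrite /complete_rel eqxx. Qed.

Definition complete_graph n : sgraph :=
  SGraph (@complete_sym n) (@complete_irr n).

Definition path_rel n : rel 'I_n := fun i j => (i.+1 == j) || (j.+1 == i).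

Fact path_rel_sym n : symmetric (@path_rel n).
Proof. by move=> i j; rewrite /path_rel orbC. Qed.

Fact path_rel_irr n : irreflexive (@path_rel n).
Proof. by move=> i; rewrite /path_rel orbb gtn_eqF. Qed.

Definition path_graph n : sgraph :=
  SGraph (@path_rel_sym n) (@path_rel_irr n).

Variables G H : sgraph.

Definition disjoint_union_rel : rel (G + H)%type := fun u v =>
  match u, v with
  | inl x, inl y => adj x y
  | inr x, inr y => adj x y
  | _, _ => false
  end.

Fact disjoint_union_sym : symmetric disjoint_union_rel.
Proof. by move=> [x|x] [y|y] //=; rewrite adj_sym. Qed.

Fact disjoint_union_irr : irreflexive disjoint_union_rel.
Proof. by move=> [x|x] /=; rewrite adj_irr. Qed.

Definition disjoint_union : sgraph :=
  SGraph disjoint_union_sym disjoint_union_irr.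

Variable A : {set G}.

Definition induced_rel : rel {x : G | x \in A} :=
  fun u v => adj (val u) (val v).

Fact induced_sym : symmetric induced_rel.
Proof. by move=> u v; rewrite /induced_rel adj_sym. Qed.

Fact induced_irr : irreflexive induced_rel.
Proof. by move=> u; rewrite /induced_rel adj_irr. Qed.

Definition induced : sgraph := SGraph induced_sym induced_irr.

End Constructions.

Definition free (F : sgraph -> Prop) (G : sgraph) : Prop :=
  forall H, F H -> forall A : {set G}, ~ iso (induced A) H.

Definition co_claw : sgraph :=
  disjoint_union (complete_graph 3) (complete_graph 1).

Definition co_gem : sgraph :=
  disjoint_union (path_graph 4) (complete_graph 1).

Definition colorable (G : sgraph) (k : nat) : bool :=
  [exists c : {ffun G -> 'I_k}, forall x, forall y, adj x y ==> (c x != c y)].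

Fact colorable_exists (G : sgraph) : exists k, colorable G k.
Proof.
exists #|G|; apply/existsP; exists [ffun x => enum_rank x].
apply/forallP=> x; apply/forallP=> y; apply/implyP=> xy.
rewrite !ffunE; apply: contraTneq xy => /enum_rank_inj ->.
by rewrite adj_irr.
Qed.

Definition chi (G : sgraph) : nat := ex_minn (colorable_exists G).

(* The empty graph is connected here; branch sets are required to be
   non-empty separately. *)
Definition connected (G : sgraph) : bool :=
  [forall x : G, forall y : G, connect (@adj G) x y].

Definition is_model (H G : sgraph) (S : {ffun H -> {set G}}) : bool :=
  [&& [forall x, (S x != set0) && connected (induced (S x))],
      [forall x, forall y, (x != y) ==> [disjoint S x & S y]]
    & [forall x, forall y, adj x y ==>
        [exists u in S x, exists v in S y, adj u v]]].

Definition is_small (H G : sgraph) (S : {ffun H -> {set G}}) : bool :=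
  [forall x, (#|S x| == 1) || (#|S x| == 2)].

Definition has_small_model (H G : sgraph) : bool :=
  [exists S : {ffun H -> {set G}}, is_model S && is_small S].

Fact small_complete_model_exists (G : sgraph) :
  exists t, has_small_model (complete_graph t) G.
Proof.
exists 0; apply/existsP; exists [ffun=> set0].
by apply/andP; split; [apply/and3P; split|]; apply/forallP; case.
Qed.

Fact small_complete_model_bound (G : sgraph) t :
  has_small_model (complete_graph t) G -> t <= #|G|.
Proof.
case/existsP=> S /andP[/and3P[/forallP S_ne /forallP S_disj _] _].
have /fin_all_exists[r rS] i : exists x : G, x \in S i.
  by have /andP[/set0Pn] := S_ne i.
suff r_inj : injective r by have := leq_card r r_inj; rewrite card_ord.
move=> i j rij; apply/eqP; apply: contraTT (rS i) => ij.
have /forallP/(_ j)/implyP/(_ ij) Dij := S_disj i.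
by rewrite (disjointFl Dij) // rij.
Qed.

Definition had2 (G : sgraph) : nat :=
  ex_maxn (small_complete_model_exists G) (@small_complete_model_bound G).

(* Main.v *)
Require Import Defs.
From mathcomp Require Import all_boot.

Set Implicit Arguments.
Unset Strict Implicit.
Unset Printing Implicit Defensive.

(** Write H for the complement of G, and call vertices that are equal or
    non-adjacent in G co-neighbours.  H has no induced claw and no induced gem,
    so the co-neighbours of a vertex induce in G a graph without triangles and
    without induced paths on 4 vertices.  A proper colouring of G is a cover of
    H by cliques.

    Take a minimal set U of vertices on which no number k admits both a
    k-colouring and a small K_k-model.  Two ways of shrinking U are then closed.

    - Folding: if U maps homomorphically into a proper subset X of U, a
      colouring of X pulls back to U and a model in X is a model in U
      ([good_fold]).
    - Peeling: if U minus X is covered by t cliques of H and carries t pairwise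
      linked bags each of which contains a neighbour of every vertex of X,
      then both numbers grow by t ([good_extend]).

    Folding one vertex onto another excludes dominated vertices, and folding two
    opposite vertices of an induced 4-cycle of H onto the other two excludes a
    4-cycle of H whose vertices have a common co-neighbour ([square_no_hub]).
    With claw- and gem-freeness, this makes the common co-neighbours of the ends
    of any edge of H a clique of H ([common_coneighbours]).  So H looks like the
    line graph of a triangle-free graph R: its vertices are the edges of R, and
    every vertex of R is a clique of H, namely the edges of R at that vertex.

    The rest is a local search for a set to peel off, guided by this picture.
    If an edge e e' of H lies in no triangle, which is a vertex u of degree 2
    in R, two cliques cover the co-neighbours of e and e', and two bags
    {e, q}, {e', p} match them, where p and q are adjacent private co-neighbours
    of e and e'; if no such p and q are adjacent, a folding exists
    ([third_coneighbour]).  Otherwise all degrees in R are at least 3.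
    A path with two edges e, e' in R has three vertices, hence the co-neighbours
    of e and e' are covered by three cliques.  The bags {e, q'}, {e', p'} and
    {p, q} peel them off unless a single remaining z is a co-neighbour of both
    p and q ([three_clique_reduction]).  If e, e' lie on an induced 4-cycle of
    H, then p, q can be chosen without such a z ([no_square]).  If two choices
    of {p, q} are both spoilt, by z and z', then z, z' and the two vertices p
    form an induced 4-cycle of H, so a reduction exists anyway
    ([not_minimal]). *)

(** * Forbidden induced subgraphs *)

(** Distinctness of the images follows from adjacency alone when no two vertices
    of the pattern have the same neighbours, as is the case for both forbidden
    graphs. *)
Lemma free_embedding (F : sgraph -> Prop) (G H : sgraph) (f : H -> G) :
  free F G -> F H ->
  (forall x y : H, (forall z, adj x z = adj y z) -> x = y) ->
  ~ (forall x y, adj (f x) (f y) = adj x y).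
Proof.
move=> freeG FH H_twinfree f_adj.
have f_inj : injective f.
  by move=> x y fxy; apply: H_twinfree => z; rewrite -!f_adj fxy.
pose A := [set f x | x : H].
have fA x : f x \in A by apply: imset_f.
pose h x : {y : G | y \in A} := exist _ (f x) (fA x).
have h_inj : injective h by move=> x y /(congr1 val) /f_inj.
have [h' hK h'K] : bijective h.
  apply: inj_card_bij => //.
  by rewrite card_sig -[X in _ <= X](card_imset predT f_inj) subset_leq_card.
apply: (freeG H FH A); exists h'; first by exists h.
by move=> x y; rewrite -f_adj -{2}[x]h'K -{2}[y]h'K.
Qed.

Lemma co_claw_twinfree (x y : co_claw) :
  (forall z, adj x z = adj y z) -> x = y.
Proof.
move=> xy; have k3 (i : 'I_3) := xy (inl i).
have := k3 (@Ordinal 3 0 isT); have := k3 (@Ordinal 3 1 isT).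
have {k3 xy} := k3 (@Ordinal 3 2 isT).
case: x y => [[[|[|[|?]]] Hi]|i] [[[|[|[|?]]] Hj]|j] //= *;
  by [rewrite (ord1 i) (ord1 j) | congr inl; apply: val_inj].
Qed.

Lemma co_gem_twinfree (x y : co_gem) :
  (forall z, adj x z = adj y z) -> x = y.
Proof.
move=> xy; have p4 (i : 'I_4) := xy (inl i).
have := p4 (@Ordinal 4 0 isT); have := p4 (@Ordinal 4 1 isT).
have := p4 (@Ordinal 4 2 isT); have {p4 xy} := p4 (@Ordinal 4 3 isT).
case: x y => [[[|[|[|[|?]]]] Hi]|i] [[[|[|[|[|?]]]] Hj]|j] //= *;
  by [rewrite (ord1 i) (ord1 j) | congr inl; apply: val_inj].
Qed.

Section Forbidden.

Variable G : sgraph.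
Hypothesis G_free : free (fun H => H = co_claw \/ H = co_gem) G.

(** The vertices a, b, c induce a triangle, and v would complete a co-claw. *)
Lemma nonneighbours_no_triangle (v a b c : G) :
  ~~ adj v a -> ~~ adj v b -> ~~ adj v c -> adj a b -> adj b c -> ~~ adj a c.
Proof.
move=> va vb vc ab bc; apply/negP=> ac.
pose f (u : co_claw) : G :=
  match u with inl i => nth a [:: a; b; c] i | inr _ => v end.
apply: (free_embedding (f := f) G_free _ co_claw_twinfree); first by left.
move=> [[[|[|[|?]]] Hi]|i] [[[|[|[|?]]] Hj]|j] //=;
  rewrite ?adj_irr ?ab ?bc ?ac ?(negbTE va) ?(negbTE vb) ?(negbTE vc) //;
  rewrite ?(ord1 i) ?(ord1 j) // adj_sym;
  by rewrite ?ab ?bc ?ac ?(negbTE va) ?(negbTE vb) ?(negbTE vc).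
Qed.

(** Otherwise a, b, c, d induce a path, and v would complete a co-gem. *)
Lemma nonneighbours_no_path (v a b c d : G) :
  ~~ adj v a -> ~~ adj v b -> ~~ adj v c -> ~~ adj v d ->
  adj a b -> adj b c -> adj c d ->
  ~~ adj a c -> ~~ adj b d -> adj a d.
Proof.
move=> va vb vc vd ab bc cd ac bd; apply: contraT => ad; exfalso.
pose f (u : co_gem) : G :=
  match u with inl i => nth a [:: a; b; c; d] i | inr _ => v end.
apply: (free_embedding (f := f) G_free _ co_gem_twinfree); first by right.
move=> [[[|[|[|[|?]]]] Hi]|i] [[[|[|[|[|?]]]] Hj]|j] //=;
  rewrite ?adj_irr ?ab ?bc ?cd ?(negbTE ac) ?(negbTE bd) ?(negbTE ad)
    ?(negbTE va) ?(negbTE vb) ?(negbTE vc) ?(negbTE vd) //;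
  rewrite ?(ord1 i) ?(ord1 j) // adj_sym;
  by rewrite ?ab ?bc ?cd ?(negbTE ac) ?(negbTE bd) ?(negbTE ad)
    ?(negbTE va) ?(negbTE vb) ?(negbTE vc) ?(negbTE vd).
Qed.

End Forbidden.

(** * Colourings and models of equal size *)

Section Certificates.

Variable G : sgraph.
Implicit Types (U X : {set G}) (x y z : G) (s t : G * G).

Lemma adj_neq x y : adj x y -> x != y.
Proof. by apply: contraTneq => ->; rewrite adj_irr. Qed.

Lemma separated z x y : adj x z -> ~~ adj y z -> x != y.
Proof. by move=> xz; apply: contraNneq => <-. Qed.

Definition colouring U (k : nat) (c : G -> nat) : Prop :=
  (forall x, x \in U -> c x < k) /\
  (forall x y, x \in U -> y \in U -> adj x y -> c x != c y).

(** A pair encodes the branch set of its two components, which is a singleton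
    when they are equal. *)
Definition bag_in U s : bool :=
  [&& s.1 \in U, s.2 \in U & (s.1 == s.2) || adj s.1 s.2].

Definition linked s t : bool :=
  [&& s.1 != t.1, s.1 != t.2, s.2 != t.1 & s.2 != t.2] &&
  [|| adj s.1 t.1, adj s.1 t.2, adj s.2 t.1 | adj s.2 t.2].

Definition bags_in U (ss : seq (G * G)) : bool :=
  all (bag_in U) ss && pairwise linked ss.

(** A set is good when one number is at once an upper bound for its chromatic
    number and a lower bound for the order of its small complete models. *)
Definition good U : Prop :=
  exists c ss, colouring U (size ss) c /\ bags_in U ss.

Lemma bag_inS U X s : X \subset U -> bag_in X s -> bag_in U s.
Proof. by move/subsetP=> XU /and3P[/XU U1 /XU U2 s12]; apply/and3P. Qed.

Lemma good0 : good set0.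
Proof. by exists (fun=> 0), [::]; split=> //; split=> x; rewrite inE. Qed.

Lemma good_fold U X (f : G -> G) :
  X \subset U -> (forall x, x \in U -> f x \in X) ->
  (forall x y, x \in U -> y \in U -> adj x y -> adj (f x) (f y)) ->
  good X -> good U.
Proof.
move=> XU fX f_adj [c [ss [[c_lt c_neq] /andP[ssX ss_linked]]]].
exists (c \o f), ss; split; last first.
  by rewrite /bags_in ss_linked andbT; apply: sub_all ssX => s; apply: bag_inS.
split=> [x Ux|x y Ux Uy xy] /=; first exact: c_lt (fX _ Ux).
exact: c_neq (fX _ Ux) (fX _ Uy) (f_adj _ _ Ux Uy xy).
Qed.

(** The condition on single vertices z of X suffices for linking with the bags
    in X, as every such bag contains some z. *)
Lemma good_extend U X (c0 : G -> nat) (ss0 : seq (G * G)) :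
  X \subset U -> colouring (U :\: X) (size ss0) c0 ->
  bags_in (U :\: X) ss0 ->
  (forall s z, s \in ss0 -> z \in X -> adj s.1 z || adj s.2 z) ->
  good X -> good U.
Proof.
move=> XU [c0_lt c0_neq] /andP[ss0U ss0_linked] ss0X.
case=> c [ss [[c_lt c_neq] /andP[ssX ss_linked]]].
exists (fun x => if x \in X then c x else size ss + c0 x), (ss ++ ss0).
have UX x : x \in U -> x \notin X -> x \in U :\: X by rewrite inE => -> ->.
split; first split=> [x Ux|x y Ux Uy xy].
- rewrite size_cat; case: ifPn => [/c_lt/leq_trans->//|xX].
    exact: leq_addr.
  by rewrite ltn_add2l c0_lt // UX.
- case: ifPn => xX; case: ifPn => yX; first exact: c_neq.
  + by rewrite neq_ltn (leq_trans (c_lt x xX)) ?leq_addr.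
  + by rewrite neq_ltn (leq_trans (c_lt y yX)) ?leq_addr ?orbT.
  + by rewrite eqn_add2l c0_neq ?UX.
rewrite /bags_in all_cat pairwise_cat ss_linked ss0_linked !andbT -andbA.
apply/and3P; split.
- by apply: sub_all ssX => s; apply: bag_inS.
- by apply: sub_all ss0U => s; apply: bag_inS; apply: subsetDl.
apply/allrelP => s t /(allP ssX)/and3P[s1X s2X _] t0.
have /and3P[] := allP ss0U _ t0; rewrite !inE => /andP[t1X _] /andP[t2X _] _.
have neq x y : x \in X -> y \notin X -> x != y.
  by move=> xX; apply: contraNneq => <-.
rewrite /linked !neq //= ![adj s.1 _]adj_sym.
by case/orP: (ss0X _ _ t0 s1X) => ->; rewrite ?orbT.
Qed.

End Certificates.

(** * Folding: the complement has no 4-wheel and no diamond *)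

Section MinimalCounterexample.

Variable G : sgraph.
Hypothesis G_free : free (fun H => H = co_claw \/ H = co_gem) G.

(* Minimality is stated with a double negation to stay constructive, [good]
   being a mere proposition; this is enough because the final goal is boolean. *)
Variable U : {set G}.
Hypothesis U_bad : ~ good U.
Hypothesis U_min : forall X : {set G}, X \proper U -> ~ ~ good X.

Implicit Types x y z u v : G.

Let claw_free := nonneighbours_no_triangle G_free.
Let gem_free := nonneighbours_no_path G_free.

Lemma irreducible (X : {set G}) z :
  X \subset U -> z \in U -> z \notin X -> ~ (good X -> good U).
Proof.
move=> XU zU zX extend; have /U_min : X \proper U.
  by apply/properP; split=> //; exists z.
by apply=> /extend.
Qed.

(** Otherwise every neighbour of u is a neighbour of v, and u folds onto v. *)
Lemma not_dominated u v :
  u \in U -> v \in U -> u != v -> exists2 x, x \in U & adj u x && ~~ adj v x.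
Proof.
move=> uU vU uv; apply/exists_inP; apply: contraT.
rewrite negb_exists_in => /forall_inP dom; exfalso.
have dom' x : x \in U -> adj u x -> adj v x.
  by move=> xU ux; have := dom x xU; rewrite ux negbK.
apply: (@irreducible (U :\ u) u); rewrite ?subD1set ?setD11 //.
apply: (@good_fold _ _ _ (fun x => if x == u then v else x)).
- exact: subD1set.
- move=> x xU; case: ifPn => xu; rewrite !inE ?xU ?xu //.
  by rewrite eq_sym uv.
move=> x y xU yU xy; case: (eqVneq x u) (eqVneq y u) => [xu|xu] [yu|yu] //.
- by move: xy; rewrite xu yu adj_irr.
- by apply: dom'; rewrite // -xu.
- by rewrite adj_sym; apply: dom'; rewrite // -yu adj_sym.
Qed.

(** Sending u1 to v1 and u2 to v2 would be a homomorphism; the edge v1 v2 takes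
    care of a possible edge u1 u2. *)
Lemma no_double_fold u1 u2 v1 v2 :
  u1 \in U -> v1 \in U -> v2 \in U ->
  v1 != u1 -> v1 != u2 -> v2 != u1 -> v2 != u2 -> adj v1 v2 ->
  (forall x, x \in U -> x != u1 -> x != u2 -> adj u1 x -> adj v1 x) ->
  ~ (forall x, x \in U -> x != u1 -> x != u2 -> adj u2 x -> adj v2 x).
Proof.
move=> u1U v1U v2U v1u1 v1u2 v2u1 v2u2 v12 dom1 dom2.
apply: (@irreducible (U :\: [set u1; u2]) u1); rewrite ?subsetDl ?inE ?eqxx //.
pose f x := if x == u1 then v1 else if x == u2 then v2 else x.
apply: (@good_fold _ _ _ f); first exact: subsetDl.
- move=> x xU; rewrite /f; case: eqVneq => [_|xu1].
    by rewrite !inE negb_or v1u1 v1u2.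
  case: eqVneq => [_|xu2]; first by rewrite !inE negb_or v2u1 v2u2.
  by rewrite !inE negb_or xu1 xu2.
have v21 : adj v2 v1 by rewrite adj_sym.
move=> x y xU yU xy; rewrite /f.
case: (eqVneq x u1) (eqVneq y u1) => [xu1|xu1] [yu1|yu1].
- by move: xy; rewrite xu1 yu1 adj_irr.
- by case: eqVneq => // yu2; apply: dom1; rewrite // -xu1.
- by case: eqVneq => // xu2; rewrite adj_sym; apply: dom1;
  rewrite // -yu1 adj_sym.
case: (eqVneq x u2) (eqVneq y u2) => [xu2|xu2] [yu2|yu2] //.
- by move: xy; rewrite xu2 yu2 adj_irr.
- by apply: dom2; rewrite // -xu2.
- by rewrite adj_sym; apply: dom2; rewrite // -yu2 adj_sym.
Qed.

(** Otherwise v is adjacent to the rest of U, and the single bag {v} can be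
    peeled off. *)
Lemma has_coneighbour v :
  v \in U -> exists2 x, x \in U & (x != v) && ~~ adj v x.
Proof.
move=> vU; apply/exists_inP; apply: contraT.
rewrite negb_exists_in => /forall_inP dom; exfalso.
have dom' x : x \in U -> x != v -> adj v x.
  by move=> xU xv; have := dom x xU; rewrite xv negbK.
apply: (@irreducible (U :\ v) v); rewrite ?subD1set ?setD11 //.
have UX x : x \in U :\: (U :\ v) -> x = v.
  by rewrite !inE; case: eqVneq => //= _; case: (x \in U).
apply: (@good_extend _ _ _ (fun=> 0) [:: (v, v)]); first exact: subD1set.
- by split=> // x y /UX-> /UX->; rewrite adj_irr.
- by rewrite /bags_in /bag_in /= !inE !eqxx vU.
by move=> s z; rewrite !inE => /eqP-> /andP[zv zU]; rewrite dom'.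
Qed.

(** In the complement, e1 e2 e3 e4 is an induced cycle. *)
Definition square (e1 e2 e3 e4 : G) : bool :=
  [&& adj e1 e3, adj e2 e4
    & [&& ~~ adj e1 e2, ~~ adj e2 e3, ~~ adj e3 e4 & ~~ adj e4 e1]].

(** If x were adjacent to e2, it would have, in the complement, the same
    neighbours on the square as e4.  As x is not dominated by e4, some
    co-neighbour y of e4 is adjacent to x.  It must be adjacent to e1 and e3, or
    else the co-neighbours of e1 or e3 contain the triangle y x e2 or the path
    y x e2 e4.  Then e1, e3, y is a triangle of co-neighbours of e4. *)
Lemma square_no_twin e1 e2 e3 e4 x :
  square e1 e2 e3 e4 -> e4 \in U -> x \in U -> x != e4 ->
  ~~ adj e1 x -> ~~ adj e3 x -> ~~ adj e4 x -> ~~ adj e2 x.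
Proof.
case/and3P=> e13 e24 /and4P[e12 e23 e34 e41] e4U xU xe4 e1x e3x e4x.
apply/negP=> e2x.
have [y yU /andP[xy e4y]] := not_dominated xU e4U xe4.
have y_adj e : ~~ adj e x -> ~~ adj e e2 -> ~~ adj e e4 -> adj e y.
  move=> ex ee2 ee4; apply: contraT => ey.
  have yx : adj y x by rewrite adj_sym.
  have xe2 : adj x e2 by rewrite adj_sym.
  have ye2 := claw_free ey ex ee2 yx xe2.
  have xe4' : ~~ adj x e4 by rewrite adj_sym.
  have := gem_free ey ex ee2 ee4 yx xe2 e24 ye2 xe4'.
  by rewrite adj_sym (negbTE e4y).
have e1y : adj e1 y by apply: y_adj; rewrite // adj_sym.
have ye3 : adj y e3 by rewrite adj_sym; apply: y_adj; rewrite // adj_sym.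
have e43 : ~~ adj e4 e3 by rewrite adj_sym.
by have := claw_free e41 e4y e43 e1y ye3; rewrite e13.
Qed.

(** A co-neighbour x of e1 that is adjacent to e2 must be a co-neighbour of e4.
    If it is also one of e3, it is a twin of e4 on the square; otherwise the hub
    h and x produce a co-gem, centred at e1 or at h. *)
Lemma hub_fold e1 e2 e3 e4 h x :
  square e1 e2 e3 e4 -> e4 \in U ->
  ~~ adj h e1 -> ~~ adj h e2 -> ~~ adj h e3 -> ~~ adj h e4 ->
  x \in U -> x != e4 -> adj e2 x -> adj e1 x.
Proof.
move=> sq e4U he1 he2 he3 he4 xU xe4 e2x.
have /and3P[e13 e24 /and4P[e12 e23 e34 e41]] := sq.
apply: contraT => e1x.
have xe2 : adj x e2 by rewrite adj_sym.
have e14 : ~~ adj e1 e4 by rewrite adj_sym.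
have xe4' := claw_free e1x e12 e14 xe2 e24.
have e4x : ~~ adj e4 x by rewrite adj_sym.
have [e3x|e3x] := boolP (adj e3 x); last first.
  by have := square_no_twin sq e4U xU xe4 e1x e3x e4x; rewrite e2x.
have e42 : adj e4 e2 by rewrite adj_sym.
have e1h : ~~ adj e1 h by rewrite adj_sym.
have e2h : ~~ adj e2 h by rewrite adj_sym.
have hx : ~~ adj h x.
  apply/negP=> hx; have xh : adj x h by rewrite adj_sym.
  have := gem_free e14 e12 e1x e1h e42 e2x xh e4x e2h.
  by rewrite adj_sym (negbTE he4).
have e32 : ~~ adj e3 e2 by rewrite adj_sym.
by have := gem_free he3 hx he2 he4 e3x xe2 e24 e32 xe4'; rewrite (negbTE e34).
Qed.

(** By [hub_fold], e2 and e4 can be folded onto e1 and e3. *)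
Lemma square_no_hub e1 e2 e3 e4 h :
  square e1 e2 e3 e4 -> e1 \in U -> e2 \in U -> e3 \in U -> e4 \in U ->
  ~~ adj h e1 -> ~~ adj h e2 -> ~~ adj h e3 -> ~~ adj h e4 -> False.
Proof.
move=> sq e1U e2U e3U e4U he1 he2 he3 he4.
have /and3P[e13 e24 /and4P[e12 e23 e34 e41]] := sq.
have e31 : adj e3 e1 by rewrite adj_sym.
have e42 : adj e4 e2 by rewrite adj_sym.
have sq' : square e3 e4 e1 e2 by apply/and3P; split=> //; apply/and4P.
have e43 : ~~ adj e4 e3 by rewrite adj_sym.
have e21 : ~~ adj e2 e1 by rewrite adj_sym.
apply: (@no_double_fold e2 e4 e1 e3) => //.
- by apply: separated e13 e23.
- by apply: separated e13 e43.
- by apply: separated e31 e21.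
- by apply: separated e31 e41.
- by move=> x xU _ xe4; apply: hub_fold sq e4U he1 he2 he3 he4 xU xe4.
- by move=> x xU xe2 _; apply: hub_fold sq' e2U he3 he4 he1 he2 xU xe2.
Qed.

(** As b is not dominated by v, some co-neighbour y of v is adjacent to b.
    Adjacent a and c would then give a co-claw or a co-gem centred at v, or the
    square a b c y with hub v. *)
Lemma common_coneighbours v b a c :
  v \in U -> b \in U -> a \in U -> c \in U -> b != v -> ~~ adj v b ->
  ~~ adj v a -> ~~ adj b a -> ~~ adj v c -> ~~ adj b c -> ~~ adj a c.
Proof.
move=> vU bU aU cU bv vb va ba vc bc; apply/negP=> ac.
have [y yU /andP[b_y vy]] := not_dominated bU vU bv.
have ca : adj c a by rewrite adj_sym.
have [ya|ya] := boolP (adj y a); have [yc|yc] := boolP (adj y c).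
- have ay : adj a y by rewrite adj_sym.
  by have := claw_free va vy vc ay yc; rewrite ac.
- by have := gem_free vb vy va vc b_y ya ac ba yc; rewrite (negbTE bc).
- by have := gem_free vb vy vc va b_y yc ca bc ya; rewrite (negbTE ba).
have sq : square a b c y.
  by apply/and3P; split=> //; last apply/and4P; split; rewrite // adj_sym.
exact: (square_no_hub sq aU bU cU yU va vb vc vy).
Qed.

(** * Peeling off two or three cliques of the complement *)

Lemma private_coneighbours e e' x y :
  ~~ adj e e' -> ~~ adj e x -> adj e' x -> ~~ adj e y -> adj e' y ->
  ~~ adj x y.
Proof.
move=> ee' ex e'x ey e'y; apply/negP=> xy.
have ye' : adj y e' by rewrite adj_sym.
by have := claw_free ex ey ee' xy ye'; rewrite adj_sym e'x.
Qed.

(** When the edge e e' of the complement is in no triangle, the co-neighbours of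
    e other than e' form a clique of the complement, as do those of e' other
    than e; the bags {e, q} and {e', p} are linked if p and q are adjacent. *)
Lemma two_clique_reduction e e' p q :
  e \in U -> e' \in U -> p \in U -> q \in U ->
  e' != e -> ~~ adj e e' ->
  (forall x, x \in U -> x != e -> x != e' -> ~~ adj e x -> adj e' x) ->
  ~~ adj e p -> adj e' p -> adj e q -> ~~ adj e' q -> ~~ adj p q.
Proof.
move=> eU e'U pU qU e'e ee' priv ep e'p eq e'q; apply/negP=> pq.
pose X := [set x in U | adj e x && adj e' x].
have XU : X \subset U by apply/subsetP=> x; rewrite inE => /andP[].
have eX : e \notin X by rewrite inE adj_irr /= andbF.
apply: (@irreducible X e) => //.
have UX x : x \in U -> ~~ adj e x || ~~ adj e' x -> x \in U :\: X.
  by move=> xU nx; rewrite !inE xU /= andbT negb_and.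
have e'e' : ~~ adj e' e' by rewrite adj_irr.
have e_e : ~~ adj e e by rewrite adj_irr.
have e'_e : ~~ adj e' e by rewrite adj_sym.
apply: (@good_extend _ _ _ (fun x => adj e x || (x == e') : nat)
         [:: (e, q); (e', p)]) => //.
- split=> [x _|x y]; first by case: (_ || _).
  rewrite !inE => /andP[nx xU] /andP[ny yU].
  rewrite xU /= in nx; rewrite yU /= in ny.
  case ex: (adj e x) nx => /= nx; case ey: (adj e y) ny => //= ny.
  + by rewrite (negbTE (private_coneighbours e'_e nx ex ny ey)).
  + by case: (eqVneq y e') => // ->; rewrite adj_sym (negbTE nx).
  + by case: (eqVneq x e') => // ->; rewrite (negbTE ny).
  have [->|xe'] := eqVneq x e'; have [->|ye'] := eqVneq y e' => //.
    by rewrite adj_irr.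
  have [->|xe] := eqVneq x e; first by rewrite ey.
  have [->|ye] := eqVneq y e; first by rewrite adj_sym ex.
  have e'x : adj e' x by apply: priv; rewrite ?ex.
  have e'y : adj e' y by apply: priv; rewrite ?ey.
  by rewrite (negbTE (private_coneighbours ee' _ e'x _ e'y)) ?ex ?ey.
- have pe' : adj p e' by rewrite adj_sym.
  have qe : adj q e by rewrite adj_sym.
  have qp : adj q p by rewrite adj_sym.
  have bags : all (bag_in (U :\: X)) [:: (e, q); (e', p)].
    by rewrite /= /bag_in /= !UX ?e_e ?e'e' ?ep ?e'q ?orbT //= eq e'p !orbT.
  have link : linked (e, q) (e', p).
    rewrite /linked /= qp !orbT andbT eq_sym e'e /=.
    rewrite eq_sym (separated pe' ee') (separated qe e'_e).
    exact: adj_neq.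
  by rewrite /bags_in bags /= link.
move=> s z; rewrite !inE => /orP[]/eqP-> /and3P[_ ez e'z] /=.
- by rewrite ez.
- by rewrite e'z.
Qed.

(** Without such a z, [two_clique_reduction] forbids every edge between the
    private co-neighbours of e and those of e'.  Then p and q are the only
    private ones, and the induced 4-cycle e p q e' of the complement can be
    folded: e onto e' and q onto p. *)
Lemma third_coneighbour e e' :
  e \in U -> e' \in U -> e' != e -> ~~ adj e e' ->
  exists2 z, z \in U & [&& z != e, z != e', ~~ adj e z & ~~ adj e' z].
Proof.
move=> eU e'U e'e ee'; apply/exists_inP; apply: contraT.
rewrite negb_exists_in => /forall_inP priv; exfalso.
have {}priv x : x \in U -> x != e -> x != e' -> ~~ adj e x -> adj e' x.
  by move=> xU xe xe' ex; have := priv x xU; rewrite xe xe' ex negbK.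
have [p pU /andP[e'p ep]] := not_dominated e'U eU e'e.
have e_e' : e != e' by rewrite eq_sym.
have [q qU /andP[eq e'q]] := not_dominated eU e'U e_e'.
have anti x y : x \in U -> y \in U -> ~~ adj e x -> adj e' x ->
    adj e y -> ~~ adj e' y -> ~~ adj x y.
  by move=> xU yU; apply: two_clique_reduction.
have e'_e : ~~ adj e' e by rewrite adj_sym.
have pe : ~~ adj p e by rewrite adj_sym.
have qe' : ~~ adj q e' by rewrite adj_sym.
have pe' : adj p e' by rewrite adj_sym.
have qe : adj q e by rewrite adj_sym.
have pq := anti p q pU qU ep e'p eq e'q.
apply: (@no_double_fold e q e' p) => //.
- by apply: separated e'p _; rewrite adj_sym.
- exact: separated pe' ee'.
- exact: separated pe' qe'.
- move=> x xU xe xq ex; apply: contraT => e'x.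
  have qx := private_coneighbours e'_e e'q eq e'x ex.
  have qp : ~~ adj q p by rewrite adj_sym.
  have xp : ~~ adj x p by rewrite adj_sym; apply: anti.
  have xe' : ~~ adj x e' by rewrite adj_sym.
  by have := common_coneighbours qU xU e'U pU xq qx qe' xe' qp xp; rewrite e'p.
move=> x xU xe xq qx; apply: contraT => px.
have ex := claw_free pe pq px eq qx.
have xe' : x != e' by apply: separated (_ : adj x q) _; rewrite // adj_sym.
have e'x := priv x xU xe xe' ex.
by have := anti x q xU qU ex e'x eq e'q; rewrite adj_sym qx.
Qed.

(** The three cliques of the complement are the common co-neighbours of e and e'
    and the two sets of private ones.  The bags {e, q'} and {e', p'} contain e
    and e', which are adjacent to all that remains; the bag {p, q} has no such
    member, and only a vertex z as in the conclusion prevents the reduction. *)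
Lemma three_clique_reduction e e' p p' q q' :
  e \in U -> e' \in U -> p \in U -> p' \in U -> q \in U -> q' \in U ->
  e' != e -> ~~ adj e e' ->
  ~~ adj e p -> adj e' p -> ~~ adj e p' -> adj e' p' ->
  adj e q -> ~~ adj e' q -> adj e q' -> ~~ adj e' q' ->
  p != p' -> q != q' -> adj p q -> adj p' q' ->
  exists2 z, z \in U & [&& adj e z, adj e' z, ~~ adj p z & ~~ adj q z].
Proof.
move=> eU e'U pU p'U qU q'U e'e ee' ep e'p ep' e'p' eq e'q eq' e'q' pp' qq'.
move=> pq p'q'; apply/exists_inP; apply: contraT.
rewrite negb_exists_in => /forall_inP sep; exfalso.
pose X := [set x in U | adj e x && adj e' x].
have XU : X \subset U by apply/subsetP=> x; rewrite inE => /andP[].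
have eX : e \notin X by rewrite inE adj_irr /= andbF.
apply: (@irreducible X e) => //.
have UX x : x \in U -> ~~ adj e x || ~~ adj e' x -> x \in U :\: X.
  by move=> xU nx; rewrite !inE xU /= andbT negb_and.
have e'e' : ~~ adj e' e' by rewrite adj_irr.
have e_e : ~~ adj e e by rewrite adj_irr.
have e'_e : ~~ adj e' e by rewrite adj_sym.
pose c0 x := if adj e x then 2 else adj e' x : nat.
apply: (@good_extend _ _ _ c0 [:: (e, q'); (e', p'); (p, q)]) => //.
- rewrite /c0; split=> [x _|x y]; first by case: ifP => //; case: (adj e' x).
  rewrite !inE => /andP[nx xU] /andP[ny yU].
  rewrite xU /= in nx; rewrite yU /= in ny.
  case ex: (adj e x) nx => /= nx; case ey: (adj e y) ny => //= ny.
  + by rewrite (negbTE (private_coneighbours e'_e nx ex ny ey)).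
  + by case: (adj e' y).
  + by case: (adj e' x).
  move/negbT: ex => ex; move/negbT: ey => ey.
  case e'x: (adj e' x); case e'y: (adj e' y) => //.
    by rewrite (negbTE (private_coneighbours ee' ex e'x ey e'y)).
  move/negbT: e'x => e'x; move/negbT: e'y => e'y.
  by rewrite (negbTE (common_coneighbours eU e'U xU yU e'e ee' ex e'x ey e'y)).
- have pe' : adj p e' by rewrite adj_sym.
  have p'e' : adj p' e' by rewrite adj_sym.
  have qe : adj q e by rewrite adj_sym.
  have q'e : adj q' e by rewrite adj_sym.
  have q'p' : adj q' p' by rewrite adj_sym.
  have qe' : ~~ adj q e' by rewrite adj_sym.
  have q'e' : ~~ adj q' e' by rewrite adj_sym.
  have pe : ~~ adj p e by rewrite adj_sym.
  have p'e : ~~ adj p' e by rewrite adj_sym.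
  have bags : all (bag_in (U :\: X)) [:: (e, q'); (e', p'); (p, q)].
    by rewrite /= /bag_in /= !UX ?e_e ?e'e' ?ep ?ep' ?e'q ?e'q' ?orbT //=
      eq' e'p' pq !orbT.
  have ee'N : e != e' by rewrite eq_sym.
  have link1 : linked (e, q') (e', p').
    rewrite /linked /= ee'N q'p' !orbT andbT /=.
    rewrite eq_sym (separated p'e' ee') (separated q'e e'_e).
    exact: separated q'e p'e.
  have link2 : linked (e, q') (p, q).
    rewrite /linked /= eq /= orbT andbT.
    rewrite eq_sym (separated pe' ee') eq_sym (separated qe e_e).
    by rewrite (separated q'e pe) eq_sym.
  have link3 : linked (e', p') (p, q).
    rewrite /linked /= e'p /= andbT.
    rewrite eq_sym (separated pe' e'e') eq_sym (separated qe e'_e).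
    by rewrite eq_sym pp' eq_sym (separated qe p'e).
  by rewrite /bags_in bags /= link1 link2 link3.
move=> s z; rewrite !inE => /or3P[]/eqP-> /and3P[zU ez e'z] /=.
- by rewrite ez.
- by rewrite e'z.
by have := sep z zU; rewrite ez e'z /= negb_and !negbK.
Qed.

(** A third vertex p' of a triangle of the complement on the edge e p is not a
    co-neighbour of e', since otherwise e' and p would be common co-neighbours
    of e and p'. *)
Lemma second_private_coneighbour e e' p :
  e \in U -> e' \in U -> p \in U -> e' != e -> ~~ adj e e' ->
  ~~ adj e p -> adj e' p ->
  exists2 p', p' \in U & [&& p' != p, ~~ adj p p', ~~ adj e p' & adj e' p'].
Proof.
move=> eU e'U pU e'e ee' ep e'p.
have pe : p != e by apply: separated (_ : adj p e') ee'; rewrite adj_sym.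
have [p' p'U /and4P[p'e p'p ep' pp']] := third_coneighbour eU pU pe ep.
exists p'; rewrite // p'p ep' pp' /=; apply: contraT => e'p'.
rewrite adj_sym in e'p'; rewrite adj_sym in pp'.
have := common_coneighbours eU p'U e'U pU p'e ep' ee' e'p' ep pp'.
by rewrite e'p.
Qed.

(** Otherwise e p q e' is an induced 4-cycle of the complement.  The bags
    {e, q'}, {e', p}, {p', q} fit into [three_clique_reduction], and the z that
    it provides gives a contradiction: it is a co-neighbour of p, since
    p, e', z may not be a triangle of co-neighbours of q, so the adjacent
    vertices e and z are both common co-neighbours of p and p'. *)
Lemma no_square e e' p q :
  e \in U -> e' \in U -> p \in U -> q \in U -> e' != e -> ~~ adj e e' ->
  ~~ adj e p -> adj e' p -> adj e q -> ~~ adj e' q -> adj p q.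
Proof.
move=> eU e'U pU qU e'e ee' ep e'p eq e'q; apply: contraT => pq.
have e'_e : ~~ adj e' e by rewrite adj_sym.
have e_e' : e != e' by rewrite eq_sym.
have pe : ~~ adj p e by rewrite adj_sym.
have qe' : ~~ adj q e' by rewrite adj_sym.
have qp : ~~ adj q p by rewrite adj_sym.
have [p' p'U /and4P[p'p pp' ep' e'p']] :=
  second_private_coneighbour eU e'U pU e'e ee' ep e'p.
have [q' q'U /and4P[q'q qq' e'q' eq']] :=
  second_private_coneighbour e'U eU qU e_e' e'_e e'q eq.
have p'e : ~~ adj p' e by rewrite adj_sym.
have q'e' : ~~ adj q' e' by rewrite adj_sym.
have p'q : adj p' q.
  apply: contraT => p'q.
  by have := common_coneighbours pU p'U eU qU p'p pp' pe p'e pq p'q; rewrite eq.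
have pq' : adj p q'.
  rewrite adj_sym; apply: contraT => q'p.
  have := common_coneighbours qU q'U e'U pU q'q qq' qe' q'e' qp q'p.
  by rewrite e'p.
have qq'N : q != q' by rewrite eq_sym.
have [z zU /and4P[ez e'z p'z qz]] := three_clique_reduction eU e'U p'U pU qU q'U
  e'e ee' ep' e'p' ep e'p eq e'q eq' e'q' p'p qq'N p'q pq'.
have pe' : adj p e' by rewrite adj_sym.
have pz := claw_free qp qe' qz pe' e'z.
by have := common_coneighbours pU p'U eU zU p'p pp' pe p'e pz p'z; rewrite ez.
Qed.

(** By [no_square], every private co-neighbour of e is adjacent to every one of
    e', hence [three_clique_reduction] applies to both pairs (p, q) and (p', q).
    The obstacles z and z' are co-neighbours, as they are adjacent to e' and the
    three are co-neighbours of q.  So z p p' z' is an induced 4-cycle of the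
    complement, against [no_square]. *)
Lemma not_minimal : U != set0 -> False.
Proof.
case/set0Pn=> e eU.
have [e' e'U /andP[e'e ee']] := has_coneighbour eU.
have e'_e : ~~ adj e' e by rewrite adj_sym.
have e_e' : e != e' by rewrite eq_sym.
have [p pU /andP[e'p ep]] := not_dominated e'U eU e'e.
have [q qU /andP[eq e'q]] := not_dominated eU e'U e_e'.
have [p' p'U /and4P[p'p pp' ep' e'p']] :=
  second_private_coneighbour eU e'U pU e'e ee' ep e'p.
have [q' q'U /and4P[q'q qq' e'q' eq']] :=
  second_private_coneighbour e'U eU qU e_e' e'_e e'q eq.
have cross x y : x \in U -> y \in U -> ~~ adj e x -> adj e' x ->
    adj e y -> ~~ adj e' y -> adj x y.
  by move=> xU yU; apply: no_square.
have qq'N : q != q' by rewrite eq_sym.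
have pp'N : p != p' by rewrite eq_sym.
have [z zU /and4P[ez e'z pz qz]] := three_clique_reduction eU e'U pU p'U qU q'U
  e'e ee' ep e'p ep' e'p' eq e'q eq' e'q' pp'N qq'N
  (cross p q pU qU ep e'p eq e'q) (cross p' q' p'U q'U ep' e'p' eq' e'q').
have [z' z'U /and4P[ez' e'z' p'z' qz']] :=
  three_clique_reduction eU e'U p'U pU qU q'U
  e'e ee' ep' e'p' ep e'p eq e'q eq' e'q' p'p qq'N
  (cross p' q p'U qU ep' e'p' eq e'q) (cross p q' pU q'U ep e'p eq' e'q').
have qe' : ~~ adj q e' by rewrite adj_sym.
have zz' := private_coneighbours qe' qz e'z qz' e'z'.
have pe : ~~ adj p e by rewrite adj_sym.
have p'e : ~~ adj p' e by rewrite adj_sym.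
have p'z : adj p' z.
  apply: contraT => p'z.
  by have := common_coneighbours pU p'U eU zU p'p pp' pe p'e pz p'z; rewrite ez.
have pz' : adj p z'.
  apply: contraT => pz'.
  have := common_coneighbours pU p'U eU z'U p'p pp' pe p'e pz' p'z'.
  by rewrite ez'.
have z'p : adj z' p by rewrite adj_sym.
have zp : ~~ adj z p by rewrite adj_sym.
have zp' : adj z p' by rewrite adj_sym.
have z'p' : ~~ adj z' p' by rewrite adj_sym.
have := no_square zU z'U pU p'U (separated z'p zp) zz' zp z'p zp' z'p'.
by rewrite (negbTE pp').
Qed.

End MinimalCounterexample.

(** * From good sets to the chromatic number and small models *)

Lemma not_bad (G : sgraph) (U : {set G}) :
  free (fun H => H = co_claw \/ H = co_gem) G -> ~ ~ good U.
Proof.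
move=> G_free; have [m] := ubnP #|U|; elim: m U => // m IHm U Um U_bad.
apply: (not_minimal G_free U_bad).
  by move=> X /proper_card XU; apply: IHm; apply: leq_trans XU _.
by apply/eqP=> U0; apply: U_bad; rewrite U0; apply: good0.
Qed.

Lemma linked_sym (G : sgraph) : symmetric (@linked G).
Proof.
move=> s t; rewrite /linked !(eq_sym t.1) !(eq_sym t.2).
rewrite !(adj_sym t.1) !(adj_sym t.2).
by congr (~~ _ && _ && (_ || _)); [rewrite andbCA | rewrite orbCA].
Qed.

Lemma good_chi_le_had2 (G : sgraph) : good [set: G] -> chi G <= had2 G.
Proof.
case=> c [ss [[c_lt c_neq] /andP[ssG ss_linked]]].
apply: (@leq_trans (size ss)).
  rewrite /chi; case: ex_minnP => k _; apply; apply/existsP.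
  exists [ffun x => Ordinal (c_lt x (in_setT x))].
  apply/forallP=> x; apply/forallP=> y; apply/implyP=> xy.
  by rewrite !ffunE -val_eqE /= c_neq ?inE.
rewrite /had2; case: ex_maxnP => k _; apply; apply/existsP.
pose bag (i : 'I_(size ss)) := tnth (in_tuple ss) i.
have bag_adj i : (bag i).1 == (bag i).2 \/ adj (bag i).1 (bag i).2.
  by apply/orP; have /and3P[] := allP ssG _ (mem_tnth i (in_tuple ss)).
have bag_linked i j : i != j -> linked (bag i) (bag j).
  wlog ij : i j / i < j => [IH ij|_].
    case: (ltngtP i j) (ij) => [/IH->//|ji|/val_inj->]; last by rewrite eqxx.
    by rewrite linked_sym IH // eq_sym.
  rewrite /bag !(tnth_nth (bag i)).
  by apply: (pairwiseP (bag i) ss_linked); rewrite ?inE ?ltn_ord.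
exists [ffun i : complete_graph (size ss) => [set (bag i).1; (bag i).2]].
apply/andP; split; last first.
  by apply/forallP=> i; rewrite ffunE cards2; case: (_ != _).
apply/and3P; split.
- apply/forallP=> i; rewrite ffunE; apply/andP; split.
    by apply/set0Pn; exists (bag i).1; rewrite !inE eqxx.
  apply/forallP=> -[x x_i]; apply/forallP=> -[y y_i].
  case: (eqVneq x y) y_i => [<- y_i|xy y_i].
    by rewrite (bool_irrelevance y_i x_i) connect0.
  apply: connect1; rewrite /adj /= /induced_rel /=.
  move: x_i y_i xy; rewrite !inE.
  case: (bag_adj i) => [/eqP->|ab]; first
    by rewrite !orbb => /eqP-> /eqP->; rewrite eqxx.
  by case/orP=> /eqP-> /orP[]/eqP->; rewrite ?eqxx // adj_sym.
- apply/forallP=> i; apply/forallP=> j; apply/implyP=> /bag_linked.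
  case/andP=> /and4P[n11 n12 n21 n22] _; rewrite !ffunE.
  by rewrite disjoints_subset; apply/subsetP=> x; rewrite !inE negb_or;
    case/orP=> /eqP->; rewrite ?n11 ?n12 ?n21.
apply/forallP=> i; apply/forallP=> j; apply/implyP=> /bag_linked.
case/andP=> _ ij; rewrite !ffunE.
suff [x xi [y yj xy]] : exists2 x, x \in [set (bag i).1; (bag i).2] &
    exists2 y, y \in [set (bag j).1; (bag j).2] & adj x y.
  by apply/exists_inP; exists x => //; apply/exists_inP; exists y.
by case/or4P: ij => a_ij; [exists (bag i).1; last exists (bag j).1
  | exists (bag i).1; last exists (bag j).2
  | exists (bag i).2; last exists (bag j).1
  | exists (bag i).2; last exists (bag j).2]; rewrite // !inE eqxx ?orbT.
Qed.

Theorem theorem1p5 (G : sgraph)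
    (G_free : free (fun H => H = co_claw \/ H = co_gem) G) :
  had2 G >= chi G.
Proof.
apply: contraT => bad; exfalso.
by apply: (@not_bad G [set: G] G_free) => /good_chi_le_had2; apply/negP.
Qed.
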